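(* Let $K=\mathbb{R}$ or $K=\mathbb{C}$, and let $\mathfrak{n}$ be the $13$-dimensional Lie algebra over $K$ with basis $\{X_1,\dots,X_6,Y_1,Y_2,Y_3,Z_1,Z_2,W_1,W_2\}$ whose only nonzero brackets among basis elements (up to skew-symmetry) are $$[X_1,Y_1]=Z_1,\quad [X_2,Y_2]=Z_2,\quad [X_3,Y_3]=-(Z_1+Z_2),$$ $$[X_4,Y_1]=W_1,\quad [X_5,Y_2]=W_2,\quad [X_6,Y_3]=-(W_1+W_2).$$ Then $\mathfrak{n}$ is indecomposable.
   Context: A Lie algebra is indecomposable if it cannot be expressed as a direct sum of proper Lie ideals. *)

(* Defs.v *)
From HB Require Import structures.
From mathcomp Require Import all_boot all_order all_algebra ring.

Set Implicit Arguments.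
Unset Strict Implicit.
Unset Printing Implicit Defensive.

Import GRing.Theory.
Local Open Scope ring_scope.

HB.mixin Record isLieAlgebra (K : fieldType) (L : Type) of Vector K L := {
  lie : L -> L -> L;
  lie_linearl : forall y : L, linear (lie^~ y);
  lie_linearr : forall x : L, linear (lie x);
  lie_alt : forall x : L, lie x x = 0;
  lie_jacobi : forall x y z : L,
    lie x (lie y z) + lie y (lie z x) + lie z (lie x y) = 0
}.

#[short(type="lieAlgType")]
HB.structure Definition LieAlgebra (K : fieldType) :=
  { L of isLieAlgebra K L & Vector K L }.

Definition lie_ideal (K : fieldType) (L : lieAlgType K) (I : {vspace L}) : Prop :=
  forall x u : L, u \in I -> lie x u \in I.

(* As I is a family of ideals, the brackets between distinct summands vanish
   automatically, so an internal direct sum of subspaces is one of Lie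
   algebras. *)
Definition indecomposable (K : fieldType) (L : lieAlgType K) : Prop :=
  ~ exists (k : nat) (I : 'I_k -> {vspace L}),
      [/\ forall i, lie_ideal (I i),
          forall i, I i != fullv,
          directv (\sum_(i < k) I i)%VS &
          (\sum_(i < k) I i)%VS = fullv].

Inductive n_index : Set :=
  | X1 | X2 | X3 | X4 | X5 | X6 | Y1 | Y2 | Y3 | Z1 | Z2 | W1 | W2.

Definition n_indices : seq n_index :=
  [:: X1; X2; X3; X4; X5; X6; Y1; Y2; Y3; Z1; Z2; W1; W2].

Definition n_table (V : zmodType) (e : n_index -> V) (a b : n_index) : V :=
  match a, b with
  | X1, Y1 => e Z1
  | X2, Y2 => e Z2
  | X3, Y3 => - (e Z1 + e Z2)
  | X4, Y1 => e W1
  | X5, Y2 => e W2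
  | X6, Y3 => - (e W1 + e W2)
  | Y1, X1 => - e Z1
  | Y2, X2 => - e Z2
  | Y3, X3 => e Z1 + e Z2
  | Y1, X4 => - e W1
  | Y2, X5 => - e W2
  | Y3, X6 => e W1 + e W2
  | _, _ => 0
  end.

Definition is_n_basis (K : fieldType) (n : lieAlgType K) (e : n_index -> n) : Prop :=
  basis_of fullv (map e n_indices) /\
  forall a b : n_index, lie (e a) (e b) = n_table e a b.

Lemma dim_n (K : fieldType) (n : lieAlgType K) (e : n_index -> n) :
  is_n_basis e -> \dim (fullv : {vspace n}) = 13.
Proof. by case=> /size_basis. Qed.

(* A model, showing that is_n_basis is satisfiable over every field. *)
Definition n_model (K : fieldType) : Type := 'rV[K]_13.

HB.instance Definition _ (K : fieldType) :=
  Vector.copy (n_model K) 'rV[K]_13.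

Section Model.
Variable K : fieldType.

Definition n_code (a : n_index) : nat :=
  match a with
  | X1 => 0 | X2 => 1 | X3 => 2 | X4 => 3 | X5 => 4 | X6 => 5
  | Y1 => 6 | Y2 => 7 | Y3 => 8 | Z1 => 9 | Z2 => 10 | W1 => 11 | W2 => 12
  end.

Definition n_ord (a : n_index) : 'I_13 := inord (n_code a).

Definition n_vec (a : n_index) : n_model K := delta_mx 0 (n_ord a).

Definition n_lie (u v : n_model K) : n_model K :=
  let m a b := u 0 (n_ord a) * v 0 (n_ord b) - u 0 (n_ord b) * v 0 (n_ord a) in
  (m X1 Y1 - m X3 Y3) *: n_vec Z1 + (m X2 Y2 - m X3 Y3) *: n_vec Z2 +
  (m X4 Y1 - m X6 Y3) *: n_vec W1 + (m X5 Y2 - m X6 Y3) *: n_vec W2.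

Lemma n_vecE a b : n_vec a 0 (n_ord b) = (n_code b == n_code a)%:R.
Proof.
have ordK c : n_ord c = n_code c :> nat by rewrite inordK //; case: c.
by rewrite mxE -(inj_eq val_inj (n_ord b)) /= !ordK.
Qed.

Lemma n_lie_linearl v : linear (n_lie^~ v).
Proof. by move=> c x y; apply/rowP=> i; rewrite !mxE; ring. Qed.

Lemma n_lie_alt u : n_lie u u = 0.
Proof. by apply/rowP=> i; rewrite !mxE; ring. Qed.

Lemma n_lie_linearr u : linear (n_lie u).
Proof. by move=> c x y; apply/rowP=> i; rewrite !mxE; ring. Qed.

Lemma n_lie_nil2 u v w : n_lie u (n_lie v w) = 0.
Proof.
have lie0 (x : n_model K) : (forall a, (n_code a < 9)%N -> x 0 (n_ord a) = 0) ->
    n_lie u x = 0.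
  by move=> x0; rewrite /n_lie !x0 // !mulr0 !subrr !scale0r !addr0.
have nvec0 a b : (n_code a < 9)%N -> (8 < n_code b)%N -> n_vec b 0 (n_ord a) = 0.
  by move=> la lb; rewrite n_vecE (ltn_eqF (leq_trans la lb)).
have mxDZ (c : K) (x y : n_model K) i : (x + c *: y) 0 i = x 0 i + c * y 0 i.
  by rewrite mxE mxE.
apply: lie0 => a la; rewrite /n_lie !mxDZ.
by rewrite [X in X + _ + _ + _]mxE !nvec0 // !mulr0 !addr0.
Qed.

Lemma n_lie_jacobi x y z :
  n_lie x (n_lie y z) + n_lie y (n_lie z x) + n_lie z (n_lie x y) = 0.
Proof. by rewrite !n_lie_nil2 !addr0. Qed.

Lemma n_table_coord (V : lmodType K) (e : n_index -> V) a b :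
  let m c d : K := (n_code c == n_code a)%:R * (n_code d == n_code b)%:R -
                   (n_code d == n_code a)%:R * (n_code c == n_code b)%:R in
  (m X1 Y1 - m X3 Y3) *: e Z1 + (m X2 Y2 - m X3 Y3) *: e Z2 +
  (m X4 Y1 - m X6 Y3) *: e W1 + (m X5 Y2 - m X6 Y3) *: e W2 = n_table e a b.
Proof.
by case: a; case: b; rewrite /= !(mulr0, mul0r, mulr1) !(subr0, sub0r, oppr0)
  !(opprK, scale0r, scale1r, scaleN1r) !(add0r, addr0, opprD).
Qed.

Lemma n_lie_table a b : n_lie (n_vec a) (n_vec b) = n_table n_vec a b.
Proof. by rewrite /n_lie !n_vecE; exact: n_table_coord. Qed.

HB.instance Definition _ :=
  isLieAlgebra.Build K (n_model K)
    n_lie_linearl n_lie_linearr n_lie_alt n_lie_jacobi.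

Lemma n_model_basis : is_n_basis n_vec.
Proof.
split; last exact: n_lie_table.
rewrite basisEdim size_map dimvf /dim /= leqnn andbT.
apply/subvP=> u _; rewrite (row_sum_delta u); apply: rpred_sum => j _.
apply: rpredZ; apply: memv_span.
have [a ->] : exists a, j = n_ord a.
  case: j => m lt_m; exists (nth X1 n_indices m); apply: val_inj.
  suff mE : m = n_code (nth X1 n_indices m) by rewrite /= inordK -mE.
  by move: m lt_m; do 13!case=> //.
rewrite -/(n_vec a); move: n_vec => e.
by case: a; rewrite /= !in_cons eqxx ?orbT.
Qed.

End Model.

(* Main.v *)
Require Import Defs.
From HB Require Import structures.
From mathcomp Require Import all_boot all_order all_algebra.
From mathcomp Require Import reals complex.

(* The projection p onto a direct factor commutes with all brackets. From
   p Z_1 = [X_1, p Y_1], p W_1 = [X_4, p Y_1], and their analogues, p is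
   diagonal in the basis of the derived algebra; the relations for Y_3 force
   its eigenvalues to agree, so p is 0 or 1 there. As the derived algebra is
   also the center, one of the two factors is central and then zero. *)

Set Implicit Arguments.
Unset Strict Implicit.
Unset Printing Implicit Defensive.

Import GRing.Theory.
Local Open Scope ring_scope.

HB.instance Definition _ (K : fieldType) (L : lieAlgType K) (x : L) :=
  GRing.isLinear.Build K L L *:%R (lie x) (lie_linearr x).

Section LieAlgebra.
Variables (K : fieldType) (L : lieAlgType K).
Implicit Types (x y u v : L) (I J : {vspace L}).

Lemma lieDl x y u : lie (x + y) u = lie x u + lie y u.
Proof. by have := lie_linearl u 1 x y; rewrite !scale1r. Qed.

Lemma lieC x y : lie x y = - lie y x.
Proof.
apply/eqP; rewrite -addr_eq0; apply/eqP.
by have := lie_alt (x + y); rewrite raddfD /= !lieDl !lie_alt add0r addr0 addrC.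
Qed.

(** Both summands are stable under [lie x], so bracketing the splitting of [y] gives the splitting
    of [lie x y]. *)
Lemma daddv_pi_lier I J x y :
  lie_ideal I -> lie_ideal J -> (I :&: J)%VS = 0%VS -> (I + J)%VS = fullv ->
  daddv_pi I J (lie x y) = lie x (daddv_pi I J y).
Proof.
move=> idI idJ dIJ sIJ.
have JI0 : (J :&: I)%VS = 0%VS by rewrite capvC.
have yIJ : y \in (I + J)%VS by rewrite sIJ memvf.
rewrite -{1}(daddv_pi_add dIJ yIJ) !raddfD /=.
rewrite (daddv_pi_id dIJ) ?idI ?memv_pi //.
set w := lie x (daddv_pi J I y).
have wJ : w \in J by rewrite idJ ?memv_pi.
have wIJ : w \in (I + J)%VS by rewrite sIJ memvf.
(* As [w] lies in [J], its splitting reads [daddv_pi I J w + w = w], so its [I]-component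
   vanishes. *)
have := daddv_pi_add dIJ wIJ; rewrite (daddv_pi_id JI0 wJ).
by rewrite -[X in _ = X]add0r => /addIr ->; rewrite addr0.
Qed.

Lemma lie_ideal_sum (T : finType) (P : pred T) (I : T -> {vspace L}) :
  (forall i, lie_ideal (I i)) -> lie_ideal (\sum_(i | P i) I i)%VS.
Proof.
move=> idI x u /memv_sumP[v vI ->]; rewrite raddf_sum /=.
by apply: memv_sumr => i Pi; apply: idI; apply: vI.
Qed.

(** Each [I i] is played against the sum of the others: if that sum were zero, [I i] would be
    everything, so [I i] itself is zero. The algebra must be nonzero because the zero algebra is the
    empty sum, with [k = 0]. *)
Lemma indecomposable_pair :
  (fullv : {vspace L}) != 0%VS ->
  (forall I J, lie_ideal I -> lie_ideal J -> (I :&: J)%VS = 0%VS ->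
     (I + J)%VS = fullv -> I = 0%VS \/ J = 0%VS) ->
  indecomposable L.
Proof.
move=> L_neq0 split0 [k [I [idI I_proper dxI sumI]]].
have I0 i : I i = 0%VS.
  have sumI_i : (I i + \sum_(j < k | j != i) I j)%VS = fullv.
    by rewrite -sumI [RHS](bigD1 i).
  have capI_i : (I i :&: \sum_(j < k | j != i) I j)%VS = 0%VS.
    by have /directv_sumP/(_ i isT) := dxI.
  have [//|J0] := split0 _ _ (idI i) (lie_ideal_sum idI) capI_i sumI_i.
  by move: sumI_i (I_proper i); rewrite J0 addv0 => ->; rewrite eqxx.
by move: L_neq0; rewrite -sumI big1 ?eqxx.
Qed.

End LieAlgebra.

Section Indecomposable.
Variables (K : fieldType) (n : lieAlgType K) (e : n_index -> n).
Hypothesis basis_e : is_n_basis e.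

(** [n_code] numbers the indices in the order of [n_indices], so this is the coefficient along
    [e a]. *)
Definition n_coef (a : n_index) : n -> K :=
  coord (in_tuple (map e n_indices)) (n_ord a).

HB.instance Definition _ a := GRing.Linear.on (n_coef a).

Lemma n_coefZ a k v : n_coef a (k *: v) = k * n_coef a v.
Proof. exact: linearZ. Qed.

Lemma n_ord_val a : n_ord a = n_code a :> nat.
Proof. by rewrite inordK //; case: a. Qed.

Lemma n_coef_basis a b : n_coef a (e b) = (n_code b == n_code a)%:R.
Proof.
have -> : e b = (in_tuple (map e n_indices))`_(n_ord b).
  by rewrite n_ord_val; case: b.
rewrite /n_coef coord_free; last exact: basis_free basis_e.1.
by rewrite -(inj_eq val_inj) /= !n_ord_val.
Qed.

Lemma n_coefK v : v = \sum_(a <- n_indices) n_coef a v *: e a.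
Proof.
have v_e : v \in <<in_tuple (map e n_indices)>>%VS.
  by rewrite (span_basis basis_e.1) memvf.
rewrite {1}(coord_span v_e) (big_nth X1) big_mkord; apply: eq_bigr => i _.
rewrite (nth_map X1) //; congr (coord _ _ _ *: _); apply: val_inj.
by rewrite /= n_ord_val; case: i; do 13!case=> //.
Qed.

Lemma lie_n_basis a v :
  lie (e a) v = \sum_(b <- n_indices) n_coef b v *: n_table e a b.
Proof.
rewrite {1}[v]n_coefK raddf_sum /=; apply: eq_bigr => b _.
by rewrite linearZ /= basis_e.2.
Qed.

Definition n_center : {vspace n} := <<[:: e Z1; e Z2; e W1; e W2]>>%VS.

Lemma memv_n_center :
  [/\ e Z1 \in n_center, e Z2 \in n_center, e W1 \in n_center & e W2 \in n_center].
Proof. by split; apply: memv_span; rewrite !inE eqxx ?orbT. Qed.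

Lemma lie_n_center x y : lie x y \in n_center.
Proof.
have [z1 z2 w1 w2] := memv_n_center.
have lie_e a v : lie (e a) v \in n_center.
  rewrite lie_n_basis; apply: rpred_sum => b _; apply: rpredZ.
  by case: a; case: b => //=; rewrite ?rpredN ?rpredD ?rpred0.
rewrite [y]n_coefK raddf_sum /=; apply: rpred_sum => a _.
by rewrite linearZ /= lieC rpredZ // rpredN.
Qed.

Lemma n_centerP u : (forall x, lie x u = 0) -> u \in n_center.
Proof.
move=> u0.
have coef0 a c :
    \sum_(b <- n_indices) n_coef b u * n_coef c (n_table e a b) = 0.
  transitivity (n_coef c (lie (e a) u)); last by rewrite u0 raddf0.
  rewrite lie_n_basis raddf_sum.
  by apply: eq_bigr => b _; rewrite /= n_coefZ.
(* Each of these nine equations isolates, up to sign, one coefficient of [u]: the three along the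
   [Y]s, then those along [X1] to [X3], then those along [X4] to [X6]. *)
have {coef0} := (coef0 X1 Z1, coef0 X2 Z2, coef0 X3 Z1,
  (coef0 Y1 Z1, coef0 Y2 Z2, coef0 Y3 Z1),
  (coef0 Y1 W1, coef0 Y2 W2, coef0 Y3 W1)).
rewrite unlock /= !(raddf0, raddfN, raddfD) /= !n_coef_basis /=.
rewrite !(mulr0, mulrN, mulr1, addr0, add0r, oppr0).
have opp0 (k : K) : - k = 0 -> k = 0 by move/eqP; rewrite oppr_eq0 => /eqP.
move=> [[[[y1 y2] /opp0 y3] [[/opp0 x1 /opp0 x2] x3]] [[/opp0 x4 /opp0 x5] x6]].
have [z1 z2 w1 w2] := memv_n_center.
rewrite [u]n_coefK unlock /= !(x1, x2, x3, x4, x5, x6, y1, y2, y3).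
by rewrite !(scale0r, add0r, addr0) !(rpredD, rpredZ).
Qed.

Lemma daddv_pi_n_center I J :
  lie_ideal I -> lie_ideal J -> (I :&: J)%VS = 0%VS -> (I + J)%VS = fullv ->
  exists k, forall z, z \in n_center -> daddv_pi I J z = k *: z.
Proof.
move=> idI idJ dIJ sIJ; set p := daddv_pi I J.
have pE a b : p (n_table e a b) = \sum_(c <- n_indices)
    n_coef c (p (e b)) *: n_table e a c.
  by rewrite -lie_n_basis -(daddv_pi_lier _ _ idI idJ dIJ sIJ) basis_e.2.
have simplE := (scaler0, addr0, add0r).
pose k b := n_coef b (p (e b)).
(* Each [X] has a nonzero bracket with a single basis vector, so only the diagonal coefficient of
   [p] at the matching [Y] survives. [Z1] and [W1] share a factor because both are brackets with
   [Y1]. *)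
have pZ1 : p (e Z1) = k Y1 *: e Z1 by rewrite (pE X1 Y1) unlock /= !simplE.
have pW1 : p (e W1) = k Y1 *: e W1 by rewrite (pE X4 Y1) unlock /= !simplE.
have pZ2 : p (e Z2) = k Y2 *: e Z2 by rewrite (pE X2 Y2) unlock /= !simplE.
have pW2 : p (e W2) = k Y2 *: e W2 by rewrite (pE X5 Y2) unlock /= !simplE.
have pZ3 : p (- (e Z1 + e Z2)) = k Y3 *: - (e Z1 + e Z2).
  by rewrite (pE X3 Y3) unlock /= !simplE.
(* In [p (e Z1 + e Z2)], the coefficients along [Z1] and [Z2] are [k Y1] and [k Y2], and both equal
   [k Y3]. *)
have k12 : k Y1 = k Y2.
  move: pZ3; rewrite raddfN scalerN => /oppr_inj.
  rewrite raddfD /= pZ1 pZ2 scalerDr => kE.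
  have := congr1 (n_coef Z1) kE; have := congr1 (n_coef Z2) kE.
  rewrite !raddfD /= !n_coefZ !n_coef_basis /=.
  by rewrite !(mulr0, mulr1, addr0, add0r) => -> ->.
exists (k Y1) => z zZ; apply/eqP; rewrite -subr_eq0.
have /subvP/(_ z zZ) : (n_center <= lker (p - k Y1 *: \1%VF)%R)%VS.
  apply/span_subvP => v; rewrite !inE memv_ker !lfun_simp subr_eq0.
  by case/or4P => /eqP ->; rewrite ?pZ1 ?pZ2 ?pW1 ?pW2 ?k12.
by rewrite memv_ker !lfun_simp.
Qed.

Lemma n_indecomposable : indecomposable n.
Proof.
apply: indecomposable_pair => [|I J idI idJ dIJ sIJ].
  by rewrite -dimv_eq0 (dim_n basis_e).
have [k pk] := daddv_pi_n_center idI idJ dIJ sIJ.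
have [Z1_center _ _ _] := memv_n_center.
(* The projection is idempotent and scales [e Z1] by [k]. *)
have : k * (k - 1) == 0.
  have := daddv_pi_proj (e Z1) dIJ; rewrite !pk ?rpredZ // scalerA.
  move/(congr1 (n_coef Z1)); rewrite !n_coefZ n_coef_basis !mulr1.
  by rewrite mulrBr mulr1 => ->; rewrite subrr.
rewrite mulf_eq0 subr_eq0 => /orP[] /eqP k_val.
  (* For [k = 0] and [u] in [I], [lie x u] is its own projection, hence zero. So [u] lies in
     [n_center], where the projection, which fixes [u], is zero. *)
  left; apply/eqP; rewrite -subv0; apply/subvP => u uI; rewrite memv0; apply/eqP.
  have pu : daddv_pi I J u = u by rewrite daddv_pi_id.
  rewrite -pu pk ?k_val ?scale0r //; apply: n_centerP => x.
  rewrite -pu -(daddv_pi_lier _ _ idI idJ dIJ sIJ) pk ?lie_n_center //.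
  by rewrite k_val scale0r.
right; apply/eqP; rewrite -subv0; apply/subvP => u uJ; rewrite memv0; apply/eqP.
have pu : daddv_pi I J u = 0.
  have uIJ : u \in (I + J)%VS by rewrite sIJ memvf.
  have := daddv_pi_add dIJ uIJ; rewrite (daddv_pi_id _ uJ) 1?capvC //.
  by rewrite -[X in _ = X]add0r => /addIr.
(* For [k = 1] the projection fixes [n_center] and kills [u]; it therefore both fixes and kills
   [lie x u]. Thus [u] lies in [n_center], and it is fixed and killed as well. *)
rewrite -[u]scale1r -k_val -pk //; apply: n_centerP => x.
rewrite -[LHS]scale1r -k_val -pk ?lie_n_center //.
by rewrite (daddv_pi_lier _ _ idI idJ dIJ sIJ) pu raddf0.
Qed.

End Indecomposable.

Theorem proposition3p1 (R : realType) :
  (forall (n : lieAlgType R) (e : n_index -> n),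
      is_n_basis e -> indecomposable n) /\
  (forall (n : lieAlgType R[i]) (e : n_index -> n),
      is_n_basis e -> indecomposable n).
Proof. by split=> n e; apply: n_indecomposable. Qed.
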